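(* Let $n\ge 3$, let $m_1,\dots,m_n>0$ be real masses, let $m_{ij}=m_{ji}$ ($i\neq j$) be real coefficients and let $\alpha\in\mathbb{R}$. If $\alpha<-1$ and the coefficients $m_{ij}$, $i\neq j$, are non-zero and all have the same sign, then there are exactly $n!/2$ collinear central configurations (counted as elements of $\mathrm{CC}_1/O(2)$).
   Context: Let $n\ge 3$, $m_1,\dots,m_n>0$, and let $m_{ij}=m_{ji}\in\mathbb{R}$ for $i\ne j$. Let $\mathcal{X}=\{z\in\mathbb{C}^n:\sum_i m_iz_i=0\}$ and $\hat{\mathcal{X}}=\{z\in\mathcal{X}: z_i\neq z_j \text{ for } i\neq j\}$ (the configurations). For $\alpha\in\mathbb{R}$ let $U\colon\hat{\mathcal{X}}\to\mathbb{R}$, $U(z)=\sum_{i<j}m_{ij}\,\phi(z_i-z_j)$, where $\phi(z)=|z|^{\alpha+2}$ if $\alpha\neq-2$ and $\phi(z)=\log|z|$ if $\alpha=-2$. A central configuration is $z\in\hat{\mathcal{X}}$ for which there is a real $k\neq 0$ with $k\,m_iz_i=\partial U/\partial z_i$ for all $i$, where $\partial U/\partial z_i$ is the gradient with respect to $z_i\in\mathbb{C}\cong\mathbb{R}^2$. Equivalently, there is a real $\lambda\ne 0$ such that $\lambda z_i=\sum_{j\neq i}m_i^{-1}m_{ij}|z_i-z_j|^{\alpha}(z_i-z_j)$ for all $i$. $\mathrm{CC}_1$ is the set of central configurations with $\sum_i m_i|z_i|^2=1$. The group $O(2)$ acts on it diagonally, through its action on the plane $\mathbb{C}\cong\mathbb{R}^2$.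 Central configurations are counted in the quotient $\mathrm{CC}_1/O(2)$. A configuration is collinear if all the $z_i$ lie on a common real line in $\mathbb{C}$ (necessarily through $0$). *)

(* Defs.v *)
From mathcomp Require Import all_boot all_order all_algebra.
From mathcomp Require Import all_classical all_reals all_analysis.
From mathcomp Require Export complex.

Set Implicit Arguments.
Unset Strict Implicit.
Unset Printing Implicit Defensive.

Import Order.TTheory GRing.Theory Num.Theory.
Import numFieldNormedType.Exports.

Local Open Scope classical_set_scope.
Local Open Scope ring_scope.
Local Open Scope complex_scope.

(* The norm of R[i] as a numDomainType is R[i]-valued; [cabs] is the
   R-valued modulus. *)
Definition cabs (R : realType) (w : R[i]) : R := ComplexField.Normc.normc w.

Definition phi (R : realType) (alpha : R) (w : R[i]) : R :=
  if alpha == - 2 then ln (cabs w) else cabs w `^ (alpha + 2).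

Section Configurations.
Variables (R : realType) (n : nat).

Definition config := 'I_n -> R[i].

Implicit Types (z : config) (m : 'I_n -> R) (c : 'I_n -> 'I_n -> R).

(* Values of [c] on the diagonal are never used below. *)
Definition U c (alpha : R) z : R :=
  \sum_(i < n) \sum_(j < n | (i < j)%N) c i j * phi alpha (z i - z j).

Definition displace z (i : 'I_n) (w : R[i]) : config :=
  fun j => if j == i then z j + w else z j.

(* Gradient with respect to z_i in C = R^2, the two partial derivatives being
   the real and imaginary parts. The formula for [U] makes sense on all of C^n
   and is smooth near any z with pairwise distinct z_i, so at such z the
   derivatives exist. *)
Definition grad (F : config -> R) (i : 'I_n) z : R[i] :=
  derive1 (fun t : R => F (displace z i (t +i* 0))) 0
  +i* derive1 (fun t : R => F (displace z i (0 +i* t))) 0.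

Definition configurations m : set config :=
  [set z | \sum_(i < n) (m i)%:C * z i = 0 /\
           forall i j, i != j -> z i != z j].

Definition central_configurations m c (alpha : R) : set config :=
  [set z | configurations m z /\
     exists2 k : R, k != 0 &
       forall i, (k * m i)%:C * z i = grad (U c alpha) i z].

Definition CC1 m c (alpha : R) : set config :=
  [set z | central_configurations m c alpha z /\
           \sum_(i < n) m i * cabs (z i) ^+ 2 = 1].

(* Real affine lines of C; no passage through 0 is imposed. *)
Definition real_line (L : set R[i]) : Prop :=
  exists a v : R[i], v != 0 /\ L = range (fun t : R => a + t%:C * v).

Definition collinear : set config :=
  [set z | exists2 L, real_line L & forall i, L (z i)].

Definition O2 : set 'M[R]_2 := [set Q | Q^T *m Q = 1%:M].

Definition plane_act (Q : 'M[R]_2) (w : R[i]) : R[i] :=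
  (Q 0 0 * complex.Re w + Q 0 1 * complex.Im w) +i* (Q 1 0 * complex.Re w + Q 1 1 * complex.Im w).

Definition O2_orbit z : set config :=
  [set (fun i => plane_act Q (z i)) | Q in O2].

(* The image of A in the quotient by O(2), an element of the quotient being
   an orbit. *)
Definition mod_O2 (A : set config) : set (set config) := O2_orbit @` A.

End Configurations.

(* Main.v *)
Require Import Defs.
From mathcomp Require Import all_boot all_order all_algebra all_fingroup.
From mathcomp Require Import all_classical all_reals all_analysis.
From mathcomp Require Import ring lra.

(** Why the count is n!/2.

The line of a collinear configuration passes through the centre of mass 0, so
the configuration can be rotated onto the real axis, and there the forces stay
on the axis.  So
the question is about real x with sum_i m_i x_i^2 = 1 solving
  l m_i x_i = sum_(j <> i) c_ij |x_i - x_j|^alpha (x_i - x_j),  l <> 0.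
The common sign of the c_ij can be moved into l, so let c_ij > 0.  Because
alpha < -1, the pair force d |-> d^(alpha + 1) is positive and decreasing for
d > 0, with limit +oo at 0: the potential is strictly concave on each chamber
(a set of all x with a prescribed order of the coordinates), with infinite
slope at the walls.  Each of the n! chambers contains exactly one solution.

Uniqueness ([real_cc_unique]): pairing the force with x shows l > 0
([rforce_virial]).  For solutions x, y of the same chamber with multipliers
l, k, monotonicity ([rforce_antitone]) makes the pairing of the force
difference with x - y nonpositive, whereas on the unit sphere it equals
(l + k)/2 times the squared distance of x and y.

Existence ([equilibrium_exists]): the forces are homogeneous, so it suffices
to solve the equation with l = 1 and no normalisation, that is, to find a
critical point of potential minus half the moment of inertia.  Maximise over
the compact part of the chamber where neighbours are at distance at least eps
and coordinates are at most B in absolute value.  Moving a maximum x towards a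
fixed point of the chamber bounds x independently of eps
([variation_bound]); opening a single gap rigidly bounds the force across this
gap by the total mass times B ([variation_gap]).  The force blows up at 0, so
for eps small neither constraint is active and x is critical.

Counting: an orbit contains exactly two real configurations, x and -x
([real_orbit_inj]), and they lie in opposite chambers.  Keeping the one with
x_0 < x_1 identifies the orbits with the permutations s with s 0 < s 1, half of
all permutations ([card_perm_lt]). *)

Import Order.TTheory GRing.Theory Num.Theory.
Import numFieldNormedType.Exports.

Set Implicit Arguments.
Unset Strict Implicit.
Unset Printing Implicit Defensive.

Local Open Scope classical_set_scope.
Local Open Scope ring_scope.

(** * The gradient of the potential *)

Definition dot (R : realType) (w v : R[i]%C) : R :=
  complex.Re w * complex.Re v + complex.Im w * complex.Im v.

(** The scalar by which the gradient of [phi] differs from |w|^alpha w.  It is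
nonzero in both cases, so multipliers absorb it and the logarithmic case needs
no separate treatment afterwards. *)
Definition kappa (R : realType) (alpha : R) : R :=
  if alpha == - 2 then 1 else alpha + 2.

Lemma kappa_neq0 (R : realType) (alpha : R) : kappa alpha != 0.
Proof.
rewrite /kappa; case: ifPn => [_|]; first exact: oner_neq0.
by rewrite addr_eq0.
Qed.

Lemma cabsE (R : realType) (w : R[i]%C) : cabs w = Num.sqrt (dot w w).
Proof. by case: w => a b; rewrite /cabs /dot /= !expr2. Qed.

Lemma dot_ge0 (R : realType) (w : R[i]%C) : 0 <= dot w w.
Proof. by rewrite /dot -!expr2 addr_ge0 ?sqr_ge0. Qed.

Lemma cabs1 (R : realType) : cabs (1 : R[i]%C) = 1.
Proof. by rewrite /cabs /= expr0n expr1n addr0 sqrtr1. Qed.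

Lemma dot_gt0 (R : realType) (w : R[i]%C) : w != 0 -> 0 < dot w w.
Proof.
case: w => a b; rewrite eq_complex /= negb_and /dot /= -!expr2 => /orP[ab|ab].
  by rewrite ltr_pwDl ?sqr_ge0// exprn_even_gt0.
by rewrite ltr_wpDl ?sqr_ge0// exprn_even_gt0.
Qed.

(** [phi] as a function of |w|^2, which, unlike |w|, is polynomial in the
coordinates. *)
Definition phi_sq (R : realType) (alpha s : R) : R :=
  if alpha == - 2 then ln s / 2 else s `^ ((alpha + 2) / 2).

Lemma phi_sqE (R : realType) (alpha : R) (w : R[i]%C) :
  phi alpha w = phi_sq alpha (dot w w).
Proof.
rewrite /phi /phi_sq cabsE -powR12_sqrt ?dot_ge0//.
by case: ifP => _; [rewrite ln_powR mulrC | rewrite -powRrM mulrC].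
Qed.

Lemma is_derive_phi_sq (R : realType) (alpha s : R) : 0 < s ->
  is_derive s 1 (phi_sq alpha) (kappa alpha / 2 * s `^ (alpha / 2)).
Proof.
move=> s0; rewrite /phi_sq /kappa; case: eqP => [->|_].
  have -> : (-2 / 2 : R) = -1 by field.
  rewrite powR_inv1 ?ltW//.
  have := is_derive1_ln s0 => h.
  have -> : (fun s : R => ln s / 2) = 2^-1 *: (@ln R).
    by apply/funext => x; rewrite mulrC.
  apply: is_derive_eq; by rewrite /GRing.scale /= ; field; rewrite gt_eqF.
apply: is_derive_eq; first exact: is_derive1_powR.
by congr (_ * powR _ _); field.
Qed.

Lemma is_derive_phi (R : realType) (alpha : R) (w v : R[i]%C) : w != 0 ->
  is_derive (0 : R) 1 (fun t : R => phi alpha (w + t%:C%C * v))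
    (kappa alpha * (cabs w `^ alpha * dot w v)).
Proof.
move=> w0.
have E : (fun t : R => phi alpha (w + t%:C%C * v)) =
   phi_sq alpha \o (fun t : R => dot w w + t * (2 * dot w v) + t ^+ 2 * dot v v).
  apply/funext => t; rewrite phi_sqE /=; congr phi_sq.
  by case: w {w0} => a b; case: v => p q; rewrite /dot /=; ring.
rewrite E.
have d1 : is_derive (0 : R) 1
   (fun t : R => dot w w + t * (2 * dot w v) + t ^+ 2 * dot v v) (2 * dot w v).
  apply: is_derive_eq; rewrite /GRing.scale /=; ring.
have d2 : is_derive (dot w w + 0 * (2 * dot w v) + 0 ^+ 2 * dot v v) 1
    (phi_sq alpha) (kappa alpha / 2 * dot w w `^ (alpha / 2)).
  by rewrite mul0r expr2 !mul0r !addr0; exact/is_derive_phi_sq/dot_gt0.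
apply: is_derive_eq.
rewrite cabsE -powR12_sqrt; last exact/ltW/dot_gt0.
by rewrite -powRrM (mulrC 2^-1); field.
Qed.

(** Passage between pairs, over which [U] sums, and forces: distributing the
action of each pair on its two members. *)
Lemma sum_ltn_sym (V : zmodType) (n : nat) (H : 'I_n -> 'I_n -> V) :
  \sum_(a < n) \sum_(b < n | (a < b)%N) (H a b + H b a) =
  \sum_(a < n) \sum_(b < n | b != a) H a b.
Proof.
under eq_bigr do rewrite big_split.
rewrite big_split /= [X in _ + X](exchange_big_dep xpredT) //= -big_split /=.
apply: eq_bigr => a _; rewrite [RHS](bigID (fun b : 'I_n => (a < b)%N)) /=.
congr (_ + _); apply: eq_bigl => b; rewrite -(inj_eq val_inj) neq_ltn.
  by case: ltngtP.
by case: ltngtP.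
Qed.

Section Force.
Variables (R : realType) (n : nat).
Implicit Types (c : 'I_n -> 'I_n -> R) (z v : config R n) (x : 'I_n -> R).

Definition force c (alpha : R) z (i : 'I_n) : R[i]%C :=
  \sum_(j < n | j != i) (c i j * cabs (z i - z j) `^ alpha)%:C%C * (z i - z j).

Lemma dotZl (k : R) (w v : R[i]%C) : dot (k%:C%C * w) v = k * dot w v.
Proof. by case: w => a b; case: v => p q; rewrite /dot /=; ring. Qed.

Lemma dotBr (w v v' : R[i]%C) : dot w (v - v') = dot w v - dot w v'.
Proof. by case: w => a b; case: v => p q; case: v' => r s; rewrite /dot /=; ring. Qed.

Lemma dotNl (w v : R[i]%C) : dot (- w) v = - dot w v.
Proof. by case: w => a b; case: v => p q; rewrite /dot /=; ring. Qed.

Lemma dot_suml (I : Type) (r : seq I) (P : pred I) (w : I -> R[i]%C) (v : R[i]%C) :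
  dot (\sum_(i <- r | P i) w i) v = \sum_(i <- r | P i) dot (w i) v.
Proof.
elim/big_rec2: _ => [|i x y _ <-]; first by rewrite /dot /= !mul0r addr0.
by case: (w i) => a b; case: y => p q; rewrite /dot /=; ring.
Qed.

Lemma cabsN (w : R[i]%C) : cabs (- w) = cabs w.
Proof. by case: w => a b; rewrite /cabs /= !sqrrN. Qed.

(** One directional derivative serves twice: along the two axes of a single
body it is the gradient in [grad], along real displacements of a real
configuration it is the first variation used for existence. *)
Lemma is_derive_U c (alpha : R) z v :
  (forall i j, i != j -> c i j = c j i) ->
  (forall i j, i != j -> z i != z j) ->
  is_derive (0 : R) 1 (fun t : R => U c alpha (fun a => z a + t%:C%C * v a))
    (kappa alpha * \sum_(a < n) dot (force c alpha z a) (v a)).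
Proof.
move=> c_sym zz.
pose h (a b : 'I_n) (t : R) : R := if (a < b)%N
  then c a b * phi alpha ((z a - z b) + t%:C%C * (v a - v b)) else 0.
pose dh (a b : 'I_n) : R := if (a < b)%N
  then c a b * (kappa alpha * (cabs (z a - z b) `^ alpha *
                  dot (z a - z b) (v a - v b))) else 0.
have -> : (fun t : R => U c alpha (fun a => z a + t%:C%C * v a)) =
    \sum_(a < n) \sum_(b < n) h a b.
  apply/funext => t; rewrite /U fct_sumE; apply: eq_bigr => a _.
  rewrite fct_sumE big_mkcond; apply: eq_bigr => b _; rewrite /h.
  by case: ifP => // _; congr (_ * phi _ _); ring.
have dhab a b : is_derive (0 : R) 1 (h a b) (dh a b).
  rewrite /h /dh; case: ifP => [ab|_]; last exact: is_derive_cst.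
  have zab : z a - z b != 0.
    by rewrite subr_eq0 zz// -(inj_eq val_inj) neq_ltn ab.
  exact/is_deriveZ/is_derive_phi.
have -> : kappa alpha * \sum_(a < n) dot (force c alpha z a) (v a) =
          \sum_(a < n) \sum_(b < n) dh a b.
  pose H a b : R := kappa alpha *
    (c a b * cabs (z a - z b) `^ alpha * dot (z a - z b) (v a)).
  transitivity (\sum_(a < n) \sum_(b < n | b != a) H a b).
    rewrite mulr_sumr; apply: eq_bigr => a _; rewrite dot_suml mulr_sumr.
    by apply: eq_bigr => b _; rewrite dotZl.
  rewrite -sum_ltn_sym; apply: eq_bigr => a _; rewrite [LHS]big_mkcond.
  apply: eq_bigr => b _; rewrite /dh; case: ifPn => // ab.
  rewrite /H (@c_sym b a) -?(inj_eq val_inj) ?neq_ltn ?ab ?orbT//.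
  by rewrite -(opprB (z a) (z b)) cabsN dotNl dotBr; ring.
by apply: is_derive_sum => a; apply: is_derive_sum.
Qed.

Lemma gradE c (alpha : R) z i :
  (forall i j, i != j -> c i j = c j i) ->
  (forall i j, i != j -> z i != z j) ->
  grad (U c alpha) i z = (kappa alpha)%:C%C * force c alpha z i.
Proof.
move=> c_sym zz.
have D (u : R[i]%C) : derive1 (fun t : R => U c alpha (displace z i (t%:C%C * u))) 0
    = kappa alpha * dot (force c alpha z i) u.
  have := @is_derive_U c alpha z (fun a => if a == i then u else 0) c_sym zz.
  rewrite (bigD1 i) //= big1 ?addr0 => [|a /negbTE ->]; last first.
    by rewrite /dot /= !mulr0 addr0.
  rewrite eqxx => -[_ <-]; rewrite derive1E.
  have -> : (fun t : R => U c alpha (displace z i (t%:C%C * u))) =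
      (fun t => U c alpha (fun a => z a + t%:C%C * (if a == i then u else 0))).
    apply/funext => t; congr U; apply/funext => a; rewrite /displace.
    by case: ifP => // _; rewrite mulr0 addr0.
  by [].
have E1 t : (t +i* 0)%C = t%:C%C * 1 :> R[i]%C by rewrite mulr1.
have E2 t : (0 +i* t)%C = t%:C%C * (0 +i* 1)%C :> R[i]%C.
  by rewrite /GRing.mul /=; congr Complex; ring.
rewrite /grad; under eq_fun do rewrite E1.
rewrite D; under eq_fun do rewrite E2.
rewrite D; case: (force c alpha z i) => a b; rewrite /dot /=.
apply/eqP; rewrite eq_complex /=; apply/andP; split; apply/eqP.
all: ring.
Qed.

Definition rforce c (alpha : R) x (i : 'I_n) : R :=
  \sum_(j < n | j != i) c i j * (`|x i - x j| `^ alpha * (x i - x j)).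

Lemma cabs_realM (r : R) (u : R[i]%C) : cabs (r%:C%C * u) = `|r| * cabs u.
Proof.
rewrite !cabsE -[`|r|]sqrtr_sqr -sqrtrM ?sqr_ge0//; congr Num.sqrt.
by case: u => a b; rewrite /dot /=; ring.
Qed.

Lemma force_line c (alpha : R) x (u : R[i]%C) i : cabs u = 1 ->
  force c alpha (fun i => (x i)%:C%C * u) i = (rforce c alpha x i)%:C%C * u.
Proof.
move=> u1; rewrite /force /rforce rmorph_sum mulr_suml; apply: eq_bigr => j _.
by rewrite -mulrBl -rmorphB cabs_realM u1 mulr1 !rmorphM !mulrA.
Qed.

End Force.

(** * Uniqueness in a chamber *)

Lemma le_powR_neg (R : realType) (b d e : R) : b <= 0 -> 0 < d -> d <= e ->
  e `^ b <= d `^ b.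
Proof.
move=> b0 d0 de; have e0 : 0 < e := lt_le_trans d0 de.
rewrite -[b]opprK !(powRN _ (- b)) lef_pV2 ?posrE ?powR_gt0//.
by apply: ge0_ler_powR; rewrite ?nnegrE ?oppr_ge0 // ltW.
Qed.

Lemma powR_mulr (R : realType) (a d : R) : 0 < d -> d `^ a * d = d `^ (a + 1).
Proof.
move=> d0; have dn : d != 0 by rewrite gt_eqF.
by rewrite powRD ?dn ?implybT// powRr1// ltW.
Qed.

(** For positive [d] the pair force is d^(a + 1), with a negative exponent.
The common sign of [d] and [e] keeps both on one branch of this function. *)
Lemma pair_force_antitone (R : realType) (a d e : R) : a < -1 ->
  d != 0 -> e != 0 -> (0 < d) = (0 < e) ->
  (`|d| `^ a * d - `|e| `^ a * e) * (d - e) <= 0.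
Proof.
move=> a1 dn en de.
wlog d0 : d e dn en de / 0 < d => [W|].
  have [/W->//|dle] := ltP 0 d.
  have ele : e <= 0 by rewrite leNgt -de -leNgt.
  have := W (- d) (- e); rewrite !oppr_eq0 !oppr_gt0 !normrN.
  move=> /(_ dn en); rewrite !lt_neqAle dn en dle ele => /(_ erefl erefl).
  by apply: le_trans; rewrite le_eqVlt; apply/orP; left; apply/eqP; ring.
have e0 : 0 < e by rewrite -de.
rewrite !gtr0_norm// !powR_mulr//.
have b0 : a + 1 <= 0 by lra.
have [le|/ltW le] := leP d e.
  by rewrite mulr_ge0_le0 ?subr_ge0 ?subr_le0 ?le_powR_neg.
by rewrite mulr_le0_ge0 ?subr_ge0 ?subr_le0 ?le_powR_neg.
Qed.

Section Uniqueness.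
Variables (R : realType) (n : nat) (alpha : R) (c : 'I_n -> 'I_n -> R).
Hypothesis alpha_lt : alpha < -1.
Hypothesis c_sym : forall i j, i != j -> c i j = c j i.
Hypothesis c_gt0 : forall i j, i != j -> 0 < c i j.
Implicit Types x y w : 'I_n -> R.

(** Virtual work: internal forces act through the mutual distances only. *)
Lemma sum_rforce x w :
  \sum_i rforce c alpha x i * w i =
  \sum_(i < n) \sum_(j < n | (i < j)%N)
    c i j * (`|x i - x j| `^ alpha * (x i - x j)) * (w i - w j).
Proof.
under eq_bigr do rewrite mulr_suml.
rewrite -sum_ltn_sym; apply: eq_bigr => i _; apply: eq_bigr => j ij.
rewrite (@c_sym j i) -?(inj_eq val_inj) ?gtn_eqF//.
by rewrite distrC; ring.
Qed.

Lemma sum_rforce_eq0 x : \sum_i rforce c alpha x i = 0.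
Proof.
have := sum_rforce x (fun=> 1); under eq_bigr do rewrite mulr1.
move=> ->; apply: big1 => i _; apply: big1 => j _.
by rewrite subrr mulr0.
Qed.

(** Concavity of the potential on a chamber, as antitonicity of its
gradient. *)
Lemma rforce_antitone x y : injective x -> injective y ->
  (forall i j, (x i < x j) = (y i < y j)) ->
  \sum_i (rforce c alpha x i - rforce c alpha y i) * (x i - y i) <= 0.
Proof.
move=> xi yi xy; under eq_bigr do rewrite mulrBl.
rewrite sumrB !(sum_rforce _ (fun i => x i - y i)) -sumrB.
apply: sumr_le0 => i _; rewrite -sumrB; apply: sumr_le0 => j ij.
have nij : i != j by rewrite -(inj_eq val_inj) ltn_eqF.
rewrite -!mulrA -mulrBr; apply: mulr_ge0_le0; first exact/ltW/c_gt0.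
have := @pair_force_antitone R alpha (x i - x j) (y i - y j) alpha_lt.
rewrite !subr_eq0 !inj_eq// !subr_gt0 => /(_ nij nij (xy j i)).
by apply: le_trans; rewrite le_eqVlt; apply/orP; left; apply/eqP; ring.
Qed.

(** The pairing is a sum of terms c_ij |x_i - x_j|^(alpha + 2); it fixes the
sign of the multiplier of a solution. *)
Lemma rforce_virial x : injective x -> (1 < n)%N ->
  0 < \sum_i rforce c alpha x i * x i.
Proof.
move=> xi n1; rewrite sum_rforce.
have pos (i j : 'I_n) : (i < j)%N ->
    0 < c i j * (`|x i - x j| `^ alpha * (x i - x j)) * (x i - x j).
  move=> ij; have nij : i != j by rewrite -(inj_eq val_inj) ltn_eqF.
  have d0 : x i - x j != 0 by rewrite subr_eq0 inj_eq.
  rewrite -!mulrA -expr2; apply: mulr_gt0; first exact: c_gt0.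
  by rewrite mulr_gt0 ?powR_gt0 ?normr_gt0 ?exprn_even_gt0.
pose i0 : 'I_n := Ordinal (ltnW n1); pose i1 : 'I_n := Ordinal n1.
rewrite (bigD1 i0)//= (bigD1 i1)//= -addrA ltr_pwDl ?pos// addr_ge0//.
  by apply: sumr_ge0 => j /andP[ij _]; exact/ltW/pos.
by apply: sumr_ge0 => i _; apply: sumr_ge0 => j ij; exact/ltW/pos.
Qed.

(** For symmetric [c] this places the centre of mass at 0: internal forces sum
to 0 and the multiplier is nonzero. *)
Definition real_cc (m : 'I_n -> R) x : Prop :=
  [/\ injective x, \sum_i m i * x i ^+ 2 = 1 &
    exists2 l : R, l != 0 & forall i, l * m i * x i = rforce c alpha x i].

(** On the unit sphere, <x, y> = 1 - |x - y|^2 / 2, so the pairing of the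
force difference with x - y is (l + k) / 2 * |x - y|^2; antitonicity makes it
nonpositive although both multipliers are positive. *)
Lemma real_cc_unique (m : 'I_n -> R) x y :
  (forall i, 0 < m i) -> (1 < n)%N ->
  real_cc m x -> real_cc m y ->
  (forall i j, (x i < x j) = (y i < y j)) -> x = y.
Proof.
move=> m0 n1 [xi x1 [l _ xE]] [yi y1 [k _ yE]] xy.
have pos z a : injective z -> \sum_i m i * z i ^+ 2 = 1 ->
    (forall i, a * m i * z i = rforce c alpha z i) -> 0 < a.
  move=> zi z1 zE; have := rforce_virial zi n1.
  under eq_bigr => i _ do rewrite -zE -mulrA -expr2 -mulrA.
  by rewrite -mulr_sumr z1 mulr1.
have l0 := pos _ _ xi x1 xE; have k0 := pos _ _ yi y1 yE.
pose D := \sum_i m i * (x i - y i) ^+ 2.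
have : (l + k) / 2 * D <= 0.
  apply: le_trans (rforce_antitone xi yi xy).
  rewrite le_eqVlt; apply/orP; left; apply/eqP.
  (* The added term vanishes on the sphere and makes the identity termwise. *)
  transitivity ((l + k) / 2 * D + (l - k) / 2 *
       (\sum_i m i * x i ^+ 2 - \sum_i m i * y i ^+ 2)).
    by rewrite x1 y1 subrr mulr0 addr0.
  rewrite -sumrB /D !mulr_sumr -big_split; apply: eq_bigr => i _ /=.
  by rewrite -xE -yE; field.
rewrite pmulr_rle0 ?divr_gt0 ?addr_gt0// => D0.
apply/funext => i; apply/eqP; rewrite -subr_eq0 -sqrf_eq0.
have nn j : true -> 0 <= m j * (x j - y j) ^+ 2.
  by move=> _; rewrite mulr_ge0 ?sqr_ge0 ?ltW.
have : D == 0 by rewrite eq_le D0 sumr_ge0.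
rewrite psumr_eq0// => /allP /(_ i (mem_index_enum _)) /=.
by rewrite mulf_eq0 gt_eqF.
Qed.

End Uniqueness.

(** * The variational problem *)

Lemma le0_derive_right (R : realType) (f : R -> R) (D : R) :
  is_derive (0 : R) 1 f D -> (\forall t \near 0^'+, f t <= f 0) -> D <= 0.
Proof.
move=> [df <-] fle; have /cvg_ex[l hl] := df.
rewrite /derive (cvg_lim _ hl)//.
have hr : (h^-1 *: (f (h *: (1 : R^o) + 0) - f 0)) @[h --> 0^'+] --> l.
  exact: cvg_dnbhs_at_right hl.
apply: (cvgr_to_le hr); near=> t.
have t0 : 0 < t by near: t; exact: nbhs_right_gt.
rewrite /GRing.scale /= mulr1 addr0 pmulr_rle0 ?invr_gt0// subr_le0.
by near: t.
Unshelve. all: by end_near. Qed.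

Section Objective.
Variables (R : realType) (n : nat) (alpha : R) (c : 'I_n -> 'I_n -> R).
Variable m : 'I_n -> R.
Hypothesis c_sym : forall i j, i != j -> c i j = c j i.
Implicit Types x y w : 'I_n -> R.

(** Its critical points solve the equation with multiplier 1.  Dropping the
constraint to the unit sphere costs nothing, since a solution can be rescaled,
and leaves a convex domain, the chamber, so that segments serve as
variations. *)
Definition objective x : R :=
  (kappa alpha)^-1 * U c alpha (fun i => (x i)%:C%C) - 2^-1 * \sum_i m i * x i ^+ 2.

Lemma is_derive_objective x w : injective x ->
  is_derive (0 : R) 1 (fun t => objective (fun i => x i + t * w i))
    (\sum_i (rforce c alpha x i - m i * x i) * w i).
Proof.
move=> xi.
have zz i j : i != j -> (x i)%:C%C != (x j)%:C%C :> R[i]%C.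
  by move=> ij; rewrite eq_complex /= eqxx andbT inj_eq.
have dU := @is_derive_U R n c alpha (fun i => (x i)%:C%C)
  (fun i => (w i)%:C%C) c_sym zz.
have dQ : is_derive (0 : R) 1 (\sum_i (fun t : R => m i * (x i + t * w i) ^+ 2))
   (\sum_i m i * (2 * x i * w i)).
  apply: is_derive_sum => i; apply: is_derive_eq.
  by rewrite /GRing.scale /=; ring.
have -> : (fun t => objective (fun i => x i + t * w i)) =
    (kappa alpha)^-1 *:
      (fun t : R => U c alpha (fun i => (x i)%:C%C + t%:C%C * (w i)%:C%C))
    - 2^-1 *: (\sum_i (fun t : R => m i * (x i + t * w i) ^+ 2)).
  apply/funext => t; rewrite /objective /= !fctE fct_sumE; congr (_ * U _ _ _ - _).
  by apply/funext => i; rewrite rmorphD rmorphM.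
apply: is_derive_eq; rewrite /GRing.scale /= mulrA mulVf ?kappa_neq0// mul1r.
rewrite mulr_sumr -sumrB; apply: eq_bigr => i _.
have E : (fun i => (x i)%:C%C) = (fun i => (x i)%:C%C * 1) :> config R n.
  by apply/funext => k; rewrite mulr1.
rewrite E force_line ?cabs1// mulr1 /dot /=.
by field.
Qed.

Lemma cvg_objective (T : Type) (F : set_system T) (FF : Filter F)
    (f : T -> 'I_n -> R) x : injective x ->
  (forall i, f t i @[t --> F] --> x i) ->
  objective (f t) @[t --> F] --> objective x.
Proof.
move=> xi fx; rewrite /objective; apply: cvgB; apply: cvgMl_tmp.
  apply: cvg_big => [|i _]; first exact: add_continuous.
  apply: cvg_big => [|j ij]; first exact: add_continuous.
  apply: cvgMl_tmp.
  have phiE (a b : R) : phi alpha (a%:C%C - b%:C%C) = phi_sq alpha ((a - b) * (a - b)).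
    by rewrite phi_sqE /dot /= subrr mul0r addr0.
  have -> : (fun t => phi alpha ((f t i)%:C%C - (f t j)%:C%C)) =
      phi_sq alpha \o (fun t => (f t i - f t j) * (f t i - f t j)).
    by apply/funext => t; rewrite phiE.
  rewrite phiE; apply: continuous_cvg.
    apply: differentiable_continuous; apply/derivable1_diffP.
    have p : 0 < (x i - x j) * (x i - x j).
      by rewrite -expr2 exprn_even_gt0//= subr_eq0 inj_eq// -(inj_eq val_inj) ltn_eqF.
    by have [] := is_derive_phi_sq alpha p.
  by apply: cvgM; apply: cvgB.
apply: cvg_big => [|i _]; first exact: add_continuous.
by apply: cvgMl_tmp; under eq_fun do rewrite expr2; rewrite expr2; apply: cvgM.
Qed.

End Objective.

Section Chamber.
Variables (R : realType) (n : nat) (alpha : R) (c : 'I_n -> 'I_n -> R).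
Variable m : 'I_n -> R.
Hypothesis alpha_lt : alpha < -1.
Hypothesis c_sym : forall i j, i != j -> c i j = c j i.
Hypothesis c_gt0 : forall i j, i != j -> 0 < c i j.
Hypothesis m_gt0 : forall i, 0 < m i.
Variable s : 'I_n -> nat.
Hypothesis s_inj : injective s.
Implicit Types x y w : 'I_n -> R.

(** A compact part of the chamber of [s].  The gap condition is imposed on all
ordered pairs instead of neighbours only, which avoids naming neighbours. *)
Definition region (eps B : R) : set ('I_n -> R) :=
  [set x | (forall i j, (s i < s j)%N -> x i + eps <= x j) /\
           forall i, `|x i| <= B].

Lemma ordered_inj x : (forall i j, (s i < s j)%N -> x i < x j) -> injective x.
Proof.
move=> sx i j xij; apply: s_inj; case: (ltngtP (s i) (s j)) => // /sx.
  by rewrite xij ltxx.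
by rewrite xij ltxx.
Qed.

Lemma ordered_lt x i j : (forall i j, (s i < s j)%N -> x i < x j) ->
  (x i < x j) = (s i < s j)%N.
Proof.
move=> sx; case: (ltngtP (s i) (s j)) => [/sx//|/sx|/s_inj ->].
  by move=> xji; rewrite lt_gtF.
by rewrite ltxx.
Qed.

Lemma region_ordered eps B x : 0 < eps -> region eps B x ->
  forall i j, (s i < s j)%N -> x i < x j.
Proof. by move=> e0 [xs _] i j /xs; apply: lt_le_trans; rewrite ltrDl. Qed.

Lemma region_max eps B : 0 < eps -> region eps B !=set0 ->
  exists2 x, region eps B x &
    forall y, region eps B y -> objective alpha c m y <= objective alpha c m x.
Proof.
move=> e0 [y0 ry0].
pose K := [set v : 'rV[R]_n | region eps B (v 0)].
have K0 : K !=set0.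
  exists (\row_i y0 i); rewrite /K /=.
  by have -> : (\row_i y0 i : 'rV[R]_n) 0 = y0 by apply/funext => i; rewrite mxE.
have coordc i : continuous (fun v : 'rV[R]_n => v 0 i).
  by move=> v; exact: coord_continuous.
have KE : K = (\bigcap_(p in [set p : 'I_n * 'I_n | (s p.1 < s p.2)%N])
     [set v : 'rV[R]_n | v 0 p.1 - v 0 p.2 <= - eps]) `&`
   [set v : 'rV[R]_n | forall i, [set` `[- B, B]] (v ord0 i)].
  apply/seteqP; split => v /=.
    move=> [h1 h2]; split => [[i j] /= ij|i].
      by have := h1 _ _ ij; lra.
    by rewrite in_itv /= -ler_norml.
  move=> [h1 h2]; split => [i j ij|i].
    by have /= := h1 (i, j) ij; lra.
  by have := h2 i; rewrite in_itv /= -ler_norml.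
have cK : compact K.
  rewrite KE setIC; apply: compact_closedI.
    by apply: (@rV_compact _ _ (fun=> [set` `[- B, B]])) => i; exact: segment_compact.
  apply: closed_bigI => -[i j] /= _.
  apply: (@preimage_closed _ _ (fun v : 'rV[R]_n => v 0 i - v 0 j) [set r | r <= - eps]).
    by move=> v _; exact: (cvgB (coordc i v) (coordc j v)).
  exact: closed_le.
have fK : {within K, continuous (fun v : 'rV[R]_n => objective alpha c m (v 0))}.
  apply: continuous_in_subspaceT => v /set_mem Kv.
  have vi : injective (v 0) by apply: ordered_inj; exact: region_ordered Kv.
  exact: (cvg_objective (nbhs_filter v) vi (fun i => coordc i v)).
have [v /set_mem Kv vmax] := compact_EVT_max K0 cK fK.
exists (v 0) => // y ry.
have E : (\row_i y i : 'rV[R]_n) 0 = y by apply/funext => i; rewrite mxE.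
by rewrite -{1}E; apply: vmax; apply/mem_set; rewrite /K /= E.
Qed.

(** The first-order condition at a maximum, for directions that enter the
region. *)
Lemma region_max_variation eps B x w : 0 < eps -> region eps B x ->
  (forall y, region eps B y -> objective alpha c m y <= objective alpha c m x) ->
  (\forall t \near 0^'+, region eps B (fun i => x i + t * w i)) ->
  \sum_i (rforce c alpha x i - m i * x i) * w i <= 0.
Proof.
move=> e0 rx xmax xw.
have xi : injective x by apply: ordered_inj; exact: region_ordered rx.
apply: (le0_derive_right (is_derive_objective alpha m c_sym w xi)).
near=> t; have -> : (fun i => x i + 0 * w i) = x.
  by apply/funext => i; rewrite mul0r addr0.
by apply: xmax; near: t.
Unshelve. all: by end_near. Qed.

(** By antitonicity the forces at [x] may be replaced by those at [y] in the
variation, which leaves sum_j m_j x_j^2 <= sum_j L_j x_j with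
L_j = m_j y_j + (force on j at y); then apply 2 L_j x_j <= m_j x_j^2 +
L_j^2 / m_j.  The bound depends on [y] only. *)
Lemma variation_bound x y : (1 < n)%N ->
  (forall i j, (s i < s j)%N -> x i < x j) ->
  (forall i j, (s i < s j)%N -> y i < y j) ->
  \sum_i (rforce c alpha x i - m i * x i) * (y i - x i) <= 0 ->
  forall i, x i ^+ 2 <=
    (\sum_j (m j * y j + rforce c alpha y j) ^+ 2 / m j) / m i.
Proof.
move=> n1 xs ys xy i.
have xi := ordered_inj xs; have yi := ordered_inj ys.
have ord k l : (x k < x l) = (y k < y l) by rewrite !ordered_lt.
have mono := rforce_antitone alpha_lt c_sym c_gt0 xi yi ord.
have vir := rforce_virial alpha c_sym c_gt0 yi n1.
rewrite ler_pdivlMr// mulrC.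
apply: (@le_trans _ _ (\sum_j m j * x j ^+ 2)).
  rewrite (bigD1 i)//= lerDl; apply: sumr_ge0 => j _.
  by rewrite mulr_ge0 ?sqr_ge0 ?ltW.
(* The inequality 2 L_j x_j <= m_j x_j^2 + L_j^2 / m_j, summed over j. *)
have amgm : 0 <= \sum_j (m j * x j - (m j * y j + rforce c alpha y j)) ^+ 2 / m j.
  by apply: sumr_ge0 => j _; rewrite mulr_ge0 ?sqr_ge0 ?invr_ge0 ?ltW.
have E : \sum_j (m j * x j - (m j * y j + rforce c alpha y j)) ^+ 2 / m j =
   \sum_j (m j * y j + rforce c alpha y j) ^+ 2 / m j
   - \sum_j m j * x j ^+ 2
   + 2 * (\sum_j (rforce c alpha x j - m j * x j) * (y j - x j)
   + \sum_j (rforce c alpha x j - rforce c alpha y j) * (x j - y j)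
   - \sum_j rforce c alpha y j * y j).
  rewrite -!big_split -!sumrB mulr_sumr -big_split; apply: eq_bigr => j _ /=.
  by field; rewrite gt_eqF.
by move: amgm; rewrite E; lra.
Qed.

(** The direction translates rigidly all bodies from [j] upwards.  It opens no
gap negatively, so every pair contributes nonnegative work and the pair [i, j]
alone is bounded by the total; the other side is the inertial term. *)
Lemma variation_gap B x i j : (forall i j, (s i < s j)%N -> x i < x j) ->
  (forall l, `|x l| <= B) -> (s i < s j)%N ->
  \sum_l (rforce c alpha x l - m l * x l) * (s j <= s l)%N%:R <= 0 ->
  c i j * (x j - x i) `^ (alpha + 1) <= (\sum_l m l) * B.
Proof.
move=> xs xB ij; under eq_bigr do rewrite mulrBl.
rewrite sumrB subr_le0 => le1.
have le2 : \sum_l m l * x l * (s j <= s l)%N%:R <= (\sum_l m l) * B.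
  rewrite mulr_suml; apply: ler_sum => l _; rewrite -mulrA.
  rewrite ler_pM2l//; case: (s j <= s l)%N; rewrite ?mulr1 ?mulr0.
    exact: le_trans (ler_norm _) (xB _).
  exact: le_trans (normr_ge0 _) (xB l).
apply: le_trans le2; apply: le_trans le1.
rewrite (sum_rforce _ c_sym).
pose T a b := c a b * (`|x a - x b| `^ alpha * (x a - x b)) *
  ((s j <= s a)%N%:R - (s j <= s b)%N%:R).
(* Work of the pair a, b: the repulsion and the opening have the same sign. *)
have T0 a b : a != b -> 0 <= T a b.
  move=> ab; rewrite /T -!mulrA; apply: mulr_ge0; first exact/ltW/c_gt0.
  apply: mulr_ge0; first exact: powR_ge0.
  have [lt|lt|/s_inj/eqP] := ltngtP (s a) (s b); last by rewrite (negbTE ab).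
    apply: mulr_le0; first by rewrite subr_le0 ltW ?xs.
    rewrite subr_le0 ler_nat.
    by case: (leqP (s j) (s a)) => // /leq_trans -> //; exact: ltnW.
  apply: mulr_ge0; first by rewrite subr_ge0 ltW ?xs.
  rewrite subr_ge0 ler_nat.
  by case: (leqP (s j) (s b)) => // /leq_trans -> //; exact: ltnW.
have Tsym a b : a != b -> T a b = T b a.
  by move=> ab; rewrite /T c_sym// distrC; ring.
have nij : i != j by apply: contraTneq ij => ->; rewrite ltnn.
have -> : c i j * (x j - x i) `^ (alpha + 1) = T j i.
  rewrite /T (c_sym nij) leqnn leqNgt ij subr0 mulr1 -powR_mulr ?subr_gt0 ?xs//.
  by rewrite gtr0_norm// subr_gt0 xs.
have key (a b : 'I_n) : (a < b)%N ->
    T a b <= \sum_(k < n) \sum_(l < n | (k < l)%N) T k l.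
  have pos (k l : 'I_n) : (k < l)%N -> 0 <= T k l.
    by move=> kl; rewrite T0// -(inj_eq val_inj) ltn_eqF.
  move=> ab; rewrite (bigD1 a)//= (bigD1 b)//= -addrA lerDl addr_ge0//.
    by apply: sumr_ge0 => l /andP[kl _]; exact: pos.
  by apply: sumr_ge0 => k _; apply: sumr_ge0 => l; exact: pos.
have [lt|lt|/val_inj/eqP] := ltngtP i j; last by rewrite (negbTE nij).
  by rewrite -Tsym//; exact: key.
exact: key.
Qed.

End Chamber.

(** * Existence in a chamber *)

Lemma near_line_lt (R : realType) (a b B : R) : a < B ->
  \forall t \near 0^'+, a + t * b <= B.
Proof.
move=> aB.
have h : (a + t * b) @[t --> (0 : R)^'+] --> a + 0 * b.
  apply: cvg_at_right_filter; apply: cvgD; first exact: cvg_cst.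
  by apply: cvgMr_tmp; exact: cvg_id.
rewrite mul0r addr0 in h.
exact: (cvgr_le _ h _ aB).
Qed.

Section Existence.
Variables (R : realType) (n : nat) (alpha : R) (c : 'I_n -> 'I_n -> R).
Variable m : 'I_n -> R.
Hypothesis alpha_lt : alpha < -1.
Hypothesis c_sym : forall i j, i != j -> c i j = c j i.
Hypothesis c_gt0 : forall i j, i != j -> 0 < c i j.
Hypothesis m_gt0 : forall i, 0 < m i.
Variable s : 'I_n -> nat.
Hypothesis s_inj : injective s.
Implicit Types x y w : 'I_n -> R.

Lemma near_norm_le x w B : (forall i, `|x i| < B) ->
  \forall t \near 0^'+, forall i, `|x i + t * w i| <= B.
Proof.
move=> xB; apply: filter_forall => i.
have /ltr_normlP[lt1 lt2] := xB i.
near=> t; apply/ler_normlP; split; last by near: t; exact: near_line_lt.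
by rewrite opprD -mulrN; near: t; exact: near_line_lt.
Unshelve. all: by end_near. Qed.

Lemma near_region_interior eps B x w :
  (forall i j, (s i < s j)%N -> x i + eps < x j) -> (forall i, `|x i| < B) ->
  \forall t \near 0^'+, region s eps B (fun i => x i + t * w i).
Proof.
move=> xs xB.
have gaps : \forall t \near (0 : R)^'+, forall p : 'I_n * 'I_n,
    (s p.1 < s p.2)%N -> x p.1 + t * w p.1 + eps <= x p.2 + t * w p.2.
  apply: filter_forall => -[i j] /=; case: (ltnP (s i) (s j)) => [ij|_]; last first.
    by near=> t.
  near=> t => _.
  have : x i + eps - x j + t * (w i - w j) <= 0.
    by near: t; apply: near_line_lt; rewrite subr_lt0 xs.
  lra.
near=> t; split=> [i j ij|]; last by near: t; exact: near_norm_le.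
have := (near gaps t); apply: (fun h => h _ (i, j) ij).
by [].
Unshelve. all: by end_near. Qed.

Lemma near_region_monotone eps B x w : region s eps B x ->
  (forall i j, (s i < s j)%N -> w i <= w j) -> (forall i, `|x i| < B) ->
  \forall t \near 0^'+, region s eps B (fun i => x i + t * w i).
Proof.
move=> [xs _] ws xB; near=> t; split=> [i j ij|]; last by near: t; exact: near_norm_le.
have t0 : 0 <= t by near: t; exact: nbhs_right_ge.
have := xs i j ij; have := ler_wpM2l t0 (ws i j ij); lra.
Unshelve. all: by end_near. Qed.

Lemma near_region_segment eps B x y : region s eps B x -> region s eps B y ->
  \forall t \near 0^'+, region s eps B (fun i => x i + t * (y i - x i)).
Proof.
move=> [xs xB] [ys yB]; near=> t.
have t0 : 0 <= t by near: t; exact: nbhs_right_ge.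
have t1 : 0 <= 1 - t by rewrite subr_ge0; near: t; exact: nbhs_right_le.
have conv (a b d e : R) : a <= b -> d <= e -> a + t * (d - a) <= b + t * (e - b).
  by move=> /(ler_wpM2l t1) ab /(ler_wpM2l t0) de; lra.
split=> [i j ij|i].
  have := conv _ _ _ _ (xs i j ij) (ys i j ij); lra.
have := xB i; have := yB i; rewrite !ler_norml => /andP[y1 y2] /andP[x1 x2].
by have := conv _ _ _ _ x1 y1; have := conv _ _ _ _ x2 y2; lra.
Unshelve. all: by end_near. Qed.

(** The order of choices matters: [B] comes from [variation_bound] before
[eps] is fixed, and [eps] is then so small that the force at distance [eps]
exceeds everything [variation_gap] permits.  The maximum therefore lies in the
interior. *)
Lemma equilibrium_exists : (1 < n)%N ->
  exists x, (forall i j, (s i < s j)%N -> x i < x j) /\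
            forall i, rforce c alpha x i = m i * x i.
Proof.
move=> n1.
(* Integer positions: gaps at least 1, so y lies in the region for all
   eps <= 1. *)
pose y i : R := (s i)%:R.
have ys i j : (s i < s j)%N -> y i < y j by rewrite ltr_nat.
pose Q := \sum_j (m j * y j + rforce c alpha y j) ^+ 2 / m j.
have Q0 : 0 <= Q.
  by apply: sumr_ge0 => j _; rewrite mulr_ge0 ?sqr_ge0 ?invr_ge0 ?ltW.
have Qm i : 0 <= Q / m i by rewrite divr_ge0 // ltW.
have y0 i : 0 <= y i by exact: ler0n.
pose B := 1 + \sum_i Q / m i + \sum_i y i.
have QB0 : 0 <= \sum_i Q / m i by exact: sumr_ge0.
have yB0 : 0 <= \sum_i y i by exact: sumr_ge0.
pose M := \sum_l m l.
have M0 : 0 <= M by apply: sumr_ge0 => i _; exact: ltW.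
have B0 : 1 <= B by rewrite /B; lra.
(* T is at least 1, to get eps <= 1, and exceeds every M * B / c i j. *)
pose T : R := 1 + \sum_i \sum_j `|M * B / c i j|.
have T1 : 1 <= T by rewrite lerDl; apply: sumr_ge0 => i _; exact: sumr_ge0.
have a1 : alpha + 1 < 0 by rewrite -ltrBrDr sub0r.
pose eps := T `^ (alpha + 1)^-1.
have e0 : 0 < eps by exact/powR_gt0/(lt_le_trans ltr01).
have e1 : eps <= 1.
  by rewrite -(powRr0 T); apply: ler_powR => //; rewrite invr_le0 ltW.
have eT : eps `^ (alpha + 1) = T.
  by rewrite /eps -powRrM mulVf ?lt_eqF// powRr1// (le_trans ler01).
have ry : region s eps B y.
  split=> [i j ij|i].
    have : y i + 1 <= y j by rewrite /y natr1 ler_nat.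
    lra.
  rewrite ger0_norm// /B (bigD1 i (F := y))//=.
  have : 0 <= \sum_(j | j != i) y j by exact: sumr_ge0.
  lra.
have [x rx xmax] := region_max alpha c m s_inj e0 (ex_intro _ y ry).
have xs := region_ordered e0 rx.
have var := region_max_variation c_sym s_inj e0 rx xmax.
have xB i : `|x i| < B.
  have := variation_bound alpha_lt c_sym c_gt0 m_gt0 s_inj n1 xs ys
    (var _ (near_region_segment rx ry)) i.
  move=> le; rewrite -(@ltr_pXn2r _ 2) ?nnegrE ?normr_ge0//; last by lra.
  rewrite real_normK ?num_real//; apply: (le_lt_trans le).
  apply: (@lt_le_trans _ _ B); last by rewrite expr2 ler_peMl//; lra.
  have : Q / m i <= \sum_i Q / m i by rewrite (bigD1 i)//= lerDl sumr_ge0.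
  by rewrite /B -/Q; lra.
have gap i j : (s i < s j)%N -> x i + eps < x j.
  move=> ij; rewrite ltNge; apply/negP => le.
  have w_mono k l : (s k < s l)%N -> (s j <= s k)%N%:R <= (s j <= s l)%N%:R :> R.
    move=> kl; rewrite ler_nat.
    by case: (leqP (s j) (s k)) => // /leq_trans -> //; exact: ltnW.
  have := variation_gap c_sym c_gt0 m_gt0 s_inj xs (fun l => ltW (xB l)) ij
    (var _ (near_region_monotone rx w_mono xB)).
  have nij : i != j by apply: contraTneq ij => ->; rewrite ltnn.
  have c0 := c_gt0 nij.
  rewrite mulrC -ler_pdivlMr// -/M; apply/negP; rewrite -ltNge.
  have d0 : 0 < x j - x i by rewrite subr_gt0 xs.
  have de : x j - x i <= eps by lra.
  apply: lt_le_trans (le_powR_neg (ltW a1) d0 de); rewrite eT.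
  apply: (@le_lt_trans _ _ `|M * B / c i j|); first exact: ler_norm.
  rewrite /T (bigD1 i)//= (bigD1 j)//=.
  have : 0 <= \sum_(l | l != j) `|M * B / c i l| by exact: sumr_ge0.
  have : 0 <= \sum_(k | k != i) \sum_j0 `|M * B / c k j0|.
    by apply: sumr_ge0 => k _; exact: sumr_ge0.
  lra.
exists x; split=> // i; apply/eqP; rewrite -subr_eq0 -sqrf_eq0.
have nn j : true -> 0 <= (rforce c alpha x j - m j * x j) ^+ 2.
  by move=> _; exact: sqr_ge0.
(* At an interior maximum the gradient itself is an admissible direction. *)
have : \sum_j (rforce c alpha x j - m j * x j) ^+ 2 == 0.
  rewrite eq_le sumr_ge0// andbT; under eq_bigr do rewrite expr2.
  exact: (var (fun j => rforce c alpha x j - m j * x j)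
    (near_region_interior _ gap xB)).
by rewrite psumr_eq0// => /allP /(_ i (mem_index_enum _)).
Qed.

Lemma rforceZ r x i : 0 < r ->
  rforce c alpha (fun i => r * x i) i = r `^ alpha * r * rforce c alpha x i.
Proof.
move=> r0; rewrite /rforce mulr_sumr; apply: eq_bigr => j _.
rewrite -mulrBr normrM gtr0_norm// powRM ?normr_ge0 ?(ltW r0)//; ring.
Qed.

(** Rescaling an equilibrium to the unit sphere: the forces are homogeneous of
degree alpha + 1, which turns the multiplier 1 into r^alpha. *)
Lemma real_cc_exists : (1 < n)%N ->
  exists x, real_cc alpha c m x /\
            forall i j, (x i < x j) = (s i < s j)%N.
Proof.
move=> n1; have [x [xs xE]] := equilibrium_exists n1.
have xi := ordered_inj s_inj xs.
pose N := \sum_i m i * x i ^+ 2.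
have N0 : 0 < N.
  have := rforce_virial alpha c_sym c_gt0 xi n1.
  by under eq_bigr do rewrite xE -mulrA -expr2.
pose r := (Num.sqrt N)^-1.
have r0 : 0 < r by rewrite invr_gt0 sqrtr_gt0.
exists (fun i => r * x i); split; last first.
  by move=> i j; rewrite ltr_pM2l// (ordered_lt s_inj).
split.
- by move=> i j /(mulfI (lt0r_neq0 r0)) /xi.
- under eq_bigr do rewrite exprMn mulrCA.
  by rewrite -mulr_sumr -/N exprVn sqr_sqrtr ?mulVf ?gt_eqF// ltW.
- exists (r `^ alpha); first by rewrite gt_eqF ?powR_gt0.
  by move=> i; rewrite rforceZ// xE; ring.
Qed.

End Existence.

(** * Orbits of real configurations *)

Section Planar.
Variable R : realType.
Implicit Types (u w : R[i]%C).

Lemma sum_I2 (F : 'I_2 -> R) : \sum_i F i = F 0 + F 1.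
Proof.
by rewrite !big_ord_recl big_ord0 addr0; congr (F _ + F _); exact: val_inj.
Qed.

Lemma plane_actM (Q P : 'M[R]_2) w :
  plane_act (Q *m P) w = plane_act Q (plane_act P w).
Proof.
rewrite /plane_act !mxE !sum_I2 /=.
by congr (_ +i* _)%C; ring.
Qed.

Lemma plane_act1 w : plane_act 1%:M w = w.
Proof. by case: w => a b; rewrite /plane_act !mxE /= ; congr (_ +i* _)%C; ring. Qed.

Lemma O2_orbit_act (n : nat) (Q : 'M[R]_2) (z : config R n) : O2 Q ->
  O2_orbit (fun i => plane_act Q (z i)) = O2_orbit z.
Proof.
rewrite /O2 /= => OQ; have OQ' := mulmx1C OQ; apply/seteqP; split => _ /= [P OP <-].
  exists (P *m Q).
    by rewrite /O2 /= trmx_mul mulmxA -(mulmxA _ _ P) OP mulmx1.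
  by apply/funext => i; rewrite plane_actM.
exists (P *m Q^T).
  by rewrite /O2 /= trmx_mul trmxK mulmxA -(mulmxA _ _ P) OP mulmx1.
by apply/funext => i; rewrite -plane_actM -mulmxA OQ mulmx1.
Qed.

Definition rotation u : 'M[R]_2 :=
  \matrix_(i, j) if i == 0 then (if j == 0 then complex.Re u else - complex.Im u)
                 else (if j == 0 then complex.Im u else complex.Re u).

Lemma rotationE u w : plane_act (rotation u) w = w * u.
Proof.
case: u => a b; case: w => p q; rewrite /plane_act !mxE /=.
by apply/eqP; rewrite eq_complex /=; apply/andP; split; apply/eqP; ring.
Qed.

Lemma rotation_O2 u : cabs u = 1 -> O2 (rotation u).
Proof.
move=> u1; have : dot u u = 1.
  by rewrite -(sqr_sqrtr (dot_ge0 u)) -cabsE u1 expr1n.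
case: u {u1} => a b; rewrite /dot /= => ab.
apply/matrixP => i j; rewrite !mxE !sum_I2 !mxE /=.
have [->|->] : i = 0 \/ i = 1.
  by case: i => [[|[|//]] hi]; [left|right]; exact/val_inj.
all: have [->|->] : j = 0 \/ j = 1;
  first by case: j => [[|[|//]] hj]; [left|right]; exact/val_inj.
all: rewrite /=.
all: rewrite ?addr0 -?ab; ring.
Qed.

(** An orthogonal map taking a nonzero real vector to a real one has its first
column on the real axis, so this column is (1, 0) or (-1, 0). *)
Lemma real_orbit_inj (n : nat) (x y : 'I_n -> R) :
  O2_orbit (fun i => (x i)%:C%C) = O2_orbit (fun i => (y i)%:C%C) ->
  x = y \/ x = (fun i => - y i).
Proof.
move=> xy; have : O2_orbit (fun i => (x i)%:C%C) (fun i => (x i)%:C%C).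
  exists 1%:M; first by rewrite /O2 /= trmx1 mulmx1.
  by apply/funext => i; rewrite plane_act1.
rewrite xy => -[Q OQ] /(congr1 (fun f => f _)) QE.
have E i : Q 0 0 * y i = x i /\ Q 1 0 * y i = 0.
  by have := QE i; rewrite /plane_act /= !mulr0 !addr0 => -[].
have [y0|/existsNP[i /eqP yi]] := pselect (forall i, y i = 0).
  by left; apply/funext => i; have [<- _] := E i; rewrite y0 mulr0.
have Q10 : Q 1 0 = 0.
  by have [_ /eqP] := E i; rewrite mulf_eq0 (negbTE yi) orbF => /eqP.
have := congr1 (fun M : 'M[R]_2 => M 0 0) OQ; rewrite !mxE sum_I2 !mxE /= Q10 mulr0 addr0.
move=> /eqP; rewrite -expr2 sqrf_eq1 => /orP[]/eqP Q00; [left|right].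
  by apply/funext => j; have [<- _] := E j; rewrite Q00 mul1r.
by apply/funext => j; have [<- _] := E j; rewrite Q00 mulN1r.
Qed.

End Planar.

Lemma cabs_gt0 (R : realType) (w : R[i]%C) : w != 0 -> 0 < cabs w.
Proof. by move=> w0; rewrite cabsE sqrtr_gt0 dot_gt0. Qed.

Section RealReduction.
Variables (R : realType) (n : nat) (m : 'I_n -> R) (c : 'I_n -> 'I_n -> R).
Variable alpha : R.
Hypothesis n_gt1 : (1 < n)%N.
Hypothesis m_gt0 : forall i, 0 < m i.
Hypothesis c_sym : forall i j, i != j -> c i j = c j i.
Implicit Types x y : 'I_n -> R.

(** The centre of mass lies on the line, so the line passes through 0; [u] is
its unit direction. *)
Lemma collinear_line (z : config R n) : configurations m z -> collinear z ->
  exists x (u : R[i]%C), cabs u = 1 /\ z = (fun i => (x i)%:C%C * u).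
Proof.
move=> [zc _] [_ [a [v [v0 ->]]]] zL.
have {}zL i : {t : R | a + t%:C%C * v = z i}.
  by apply: cid; have [t _] := zL i; exists t.
pose t i := projT1 (zL i).
have zE i : z i = a + (t i)%:C%C * v by rewrite -(projT2 (zL i)).
pose M := \sum_i m i; pose tau := (\sum_i m i * t i) / M.
have M0 : M != 0.
  rewrite gt_eqF// /M (bigD1 (Ordinal n_gt1))//= ltr_pwDl// sumr_ge0// => i _.
  exact: ltW.
have aE : a = - (tau%:C%C * v).
  have : M%:C%C * (a + tau%:C%C * v) = 0.
    rewrite mulrDr mulrA -rmorphM /= mulrC [M * tau]mulrC divfK// mulrC.
    rewrite /M !rmorph_sum !mulr_suml -big_split -[RHS]zc; apply: eq_bigr => i _ /=.
    by rewrite zE rmorphM mulrDr mulrA.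
  move=> /eqP; rewrite mulf_eq0 => /orP[|]; last by rewrite addr_eq0 => /eqP.
  by rewrite eq_complex /= (negbTE M0).
pose r := cabs v; have r0 : 0 < r by exact: cabs_gt0.
exists (fun i => (t i - tau) * r), (r^-1%:C%C * v); split.
  by rewrite cabs_realM gtr0_norm ?invr_gt0// mulVf// gt_eqF.
apply/funext => i; rewrite zE aE mulrA -rmorphM -mulrA mulfV ?gt_eqF// mulr1.
by rewrite rmorphB mulrBl addrC.
Qed.

Lemma collinear_real x : collinear (fun i => (x i)%:C%C : R[i]%C).
Proof.
exists (range (fun t : R => (0 + t%:C%C * 1 : R[i]%C))).
  by exists 0, 1; split=> //; exact: oner_neq0.
by move=> i; exists (x i) => //; rewrite add0r mulr1.
Qed.

Lemma CC1_real_cc x (u : R[i]%C) : cabs u = 1 ->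
  CC1 m c alpha (fun i => (x i)%:C%C * u) -> real_cc alpha c m x.
Proof.
move=> u1 [[[_ zz] [k k0 zE]] z1].
have u0 : u != 0.
  by apply: contra_eq_neq u1 => ->; rewrite /cabs /= expr0n addr0 sqrtr0 eq_sym oner_neq0.
split.
- move=> i j xij; apply/eqP; apply: contraT => /zz.
  by rewrite xij eqxx.
- rewrite -[RHS]z1; apply: eq_bigr => i _.
  by rewrite cabs_realM u1 mulr1 real_normK ?num_real.
- exists (k / kappa alpha); first by rewrite mulf_neq0 ?invr_eq0 ?kappa_neq0.
  move=> i; have := zE i; rewrite gradE// force_line// !mulrA -!rmorphM.
  move=> /(mulIf u0) /(congr1 (@complex.Re R)) /= E.
  apply: (mulfI (kappa_neq0 alpha)); rewrite -E; field; exact: kappa_neq0.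
Qed.

Lemma real_cc_CC1 x : real_cc alpha c m x ->
  CC1 m c alpha (fun i => (x i)%:C%C).
Proof.
move=> [xi x1 [l l0 xE]].
have E : (fun i => (x i)%:C%C) = (fun i => (x i)%:C%C * 1) :> config R n.
  by apply/funext => i; rewrite mulr1.
have zz i j : i != j -> (x i)%:C%C != (x j)%:C%C :> R[i]%C.
  by move=> ij; rewrite eq_complex /= eqxx andbT inj_eq.
split; last first.
  rewrite -[RHS]x1; apply: eq_bigr => i _.
  by rewrite -[(x i)%:C%C]mulr1 cabs_realM cabs1 mulr1 real_normK ?num_real.
split; first split=> //.
  have : l * \sum_i m i * x i = 0.
    rewrite mulr_sumr -[RHS](sum_rforce_eq0 alpha c_sym x); apply: eq_bigr => i _.
    by rewrite mulrA xE.
  move=> /eqP; rewrite mulf_eq0 (negbTE l0) => /eqP s0.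
  by under eq_bigr do rewrite -rmorphM; rewrite -rmorph_sum s0.
exists (l * kappa alpha); first by rewrite mulf_neq0 ?kappa_neq0.
move=> i; rewrite gradE// E force_line ?cabs1// mulr1 -!rmorphM -xE.
by congr (_%:C)%C; ring.
Qed.

End RealReduction.

Lemma real_ccN (R : realType) (n : nat) (alpha : R) (c : 'I_n -> 'I_n -> R) m x :
  real_cc alpha c m x -> real_cc alpha c m (fun i => - x i).
Proof.
move=> [xi x1 [l l0 xE]]; split.
- by move=> i j /oppr_inj /xi.
- by under eq_bigr do rewrite sqrrN.
- exists l => // i; rewrite mulrN xE /rforce -sumrN; apply: eq_bigr => j _.
  by rewrite -[- x i - _]opprD normrN; ring.
Qed.

(** A common sign of the coefficients moves into the multiplier. *)
Lemma real_cc_abs (R : realType) (n : nat) (alpha : R) (c : 'I_n -> 'I_n -> R)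
    (sg : R) m x :
  sg != 0 -> (forall i j, i != j -> c i j = sg * `|c i j|) ->
  real_cc alpha c m x <-> real_cc alpha (fun i j => `|c i j|) m x.
Proof.
move=> sg0 csg.
have E i : rforce c alpha x i = sg * rforce (fun i j => `|c i j|) alpha x i.
  rewrite /rforce mulr_sumr; apply: eq_bigr => j ji.
  by rewrite [RHS]mulrA -csg// eq_sym.
split=> -[xi x1 [l l0 xE]]; split=> //.
  exists (l / sg); first by rewrite mulf_neq0 ?invr_eq0.
  by move=> i; apply: (mulfI sg0); rewrite -E -xE; field.
exists (sg * l); first by rewrite mulf_neq0.
by move=> i; rewrite E -xE; ring.
Qed.

(** * Orders of the bodies and the count *)

(** The permutation sends [i] to the number of coordinates below [x i]. *)
Lemma order_type (R : realType) (n : nat) (x : 'I_n -> R) : injective x ->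
  exists s : 'S_n, forall i j, (x i < x j) = (s i < s j)%N.
Proof.
move=> xi.
pose below i := [set j : 'I_n | x j < x i]%SET.
have rkP i : (#|below i| < n)%N.
  rewrite -[X in (_ < X)%N]card_ord -cardsT; apply: proper_card.
  apply/properP; split; first exact: finset.subsetT.
  by exists i; rewrite ?inE// ltxx.
pose rk i := Ordinal (rkP i).
have rk_lt i j : x i < x j -> (rk i < rk j)%N.
  move=> ij; apply: proper_card; apply/properP; split.
    by apply/fintype.subsetP => k; rewrite !inE => /lt_trans; exact.
  by exists i; rewrite !inE ?ltxx.
have rk_mono i j : (x i < x j) = (rk i < rk j)%N.
  have [ij|ij|/xi ->] := ltgtP (x i) (x j); last by rewrite ltnn.
    by rewrite rk_lt.
  by apply/esym/negbTE; rewrite -leqNgt ltnW// rk_lt.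
have rk_inj : injective rk.
  move=> i j ij; apply: xi; apply/eqP; rewrite eq_le !leNgt !rk_mono ij.
  by rewrite ltnn.
by exists (perm rk_inj) => i j; rewrite !permE.
Qed.

(** [s i] counts the [j] with [s j < s i], so the order determines [s]. *)
Lemma perm_order_inj (n : nat) (s t : 'S_n) :
  (forall i j, (s i < s j)%N = (t i < t j)%N) -> s = t.
Proof.
move=> st; pose L (a : 'I_n) := [set k : 'I_n | (k < a)%N]%SET.
have L_lt (a b : 'I_n) : (a < b)%N -> (#|L a| < #|L b|)%N.
  move=> ab; apply: proper_card; apply/properP; split.
    by apply/fintype.subsetP => k; rewrite !inE => /ltn_trans; exact.
  by exists a; rewrite !inE ?ltnn.
apply/permP => i; have Lst : #|L (s i)| = #|L (t i)|.
  rewrite -(card_preimset (L (s i)) (@perm_inj _ s)).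
  rewrite -(card_preimset (L (t i)) (@perm_inj _ t)).
  by apply: eq_card => j; rewrite !inE.
have [/L_lt|/L_lt|/val_inj//] := ltngtP (s i) (t i).
all: by rewrite Lst ltnn.
Qed.

(** Precomposing with the transposition of [i] and [j] exchanges the set with
its complement. *)
Lemma card_perm_lt (n : nat) (i j : 'I_n) : i != j ->
  #|[set s : 'S_n | (s i < s j)%N]%SET| = (n`! %/ 2)%N.
Proof.
move=> ij; set P := [set _ | _]%SET.
have PC : (fun s : 'S_n => (tperm i j * s)%g) @^-1: P = ~: P.
  apply/setP => s; rewrite !inE !permM tpermL tpermR -leqNgt [RHS]leq_eqVlt.
  by rewrite (inj_eq val_inj) (inj_eq perm_inj) eq_sym (negbTE ij).
have := cardsC P; rewrite -PC card_preimset; last exact: mulgI.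
by rewrite card_Sn addnn -muln2 => <-; rewrite mulnK.
Qed.

Theorem theorem6 (R : realType) (n : nat) (hn : (3 <= n)%N)
    (m : 'I_n -> R) (hm : forall i, 0 < m i)
    (c : 'I_n -> 'I_n -> R)
    (c_sym : forall i j, i != j -> c i j = c j i)
    (alpha : R) (halpha : alpha < -1)
    (c_neq0 : forall i j, i != j -> c i j != 0)
    (c_sg : forall i j k l, i != j -> k != l ->
              Num.sg (c i j) = Num.sg (c k l)) :
  (mod_O2 (CC1 m c alpha `&` @collinear R n) #= `I_(n`! %/ 2))%card.
Proof.
have n1 : (1 < n)%N by exact: leq_trans hn.
pose i0 : 'I_n := Ordinal (ltnW n1); pose i1 : 'I_n := Ordinal n1.
have i01 : i0 != i1 by [].
pose ac i j := `|c i j|.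
have ac_sym i j : i != j -> ac i j = ac j i by move=> ij; rewrite /ac c_sym.
have ac_gt0 i j : i != j -> 0 < ac i j by move=> ij; rewrite normr_gt0 c_neq0.
have absE x : real_cc alpha c m x <-> real_cc alpha ac m x.
  apply: (@real_cc_abs _ _ _ _ (Num.sg (c i0 i1))); first by rewrite sgr_eq0 c_neq0.
  by move=> i j ij; rewrite (c_sg i0 i1 i j)// -numEsg.
have X (s : 'S_n) : {x | real_cc alpha ac m x /\
    forall i j, (x i < x j) = (s i < s j)%N}.
  apply: cid; apply: (real_cc_exists halpha ac_sym ac_gt0 hm _ n1).
  by move=> i j /val_inj /perm_inj.
pose x s := projT1 (X s).
have xcc s : real_cc alpha ac m (x s) by have [] := projT2 (X s).
have xs s i j : (x s i < x s j) = (s i < s j)%N by case: (projT2 (X s)) => _; apply.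
pose f (s : 'S_n) : set (config R n) := O2_orbit (fun i => (x s i)%:C%C).
pose P := [set s : 'S_n | (s i0 < s i1)%N]%SET.
have surj y : real_cc alpha ac m y -> y i0 < y i1 ->
    exists2 s, s \in P & f s = O2_orbit (fun i => (y i)%:C%C).
  move=> ycc y01; have [yi _ _] := ycc; have [s sE] := order_type yi.
  exists s; first by rewrite inE -sE.
  congr O2_orbit; apply/funext => i; congr (_%:C)%C; congr (_ i).
  apply: (real_cc_unique halpha ac_sym ac_gt0 hm n1 (xcc s) ycc) => k l.
  by rewrite xs sE.
have orbN y : O2_orbit (fun i => (- y i)%:C%C) =
    O2_orbit (fun i => (y i)%:C%C) :> set (config R n).
  have u1 : cabs (- 1 : R[i]%C) = 1 by rewrite cabsN cabs1.
  rewrite -(O2_orbit_act (fun i => (y i)%:C%C) (rotation_O2 u1)).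
  by congr O2_orbit; apply/funext => i; rewrite rotationE mulrN1 rmorphN.
have -> : mod_O2 (CC1 m c alpha `&` @collinear R n) =
    (fun k : 'I_#|P| => f (enum_val k)) @` [set: 'I_#|P|].
  apply/seteqP; split=> O /=; last first.
    move=> [k _ <-]; exists (fun i => (x (enum_val k) i)%:C%C) => //; split.
      by apply: real_cc_CC1 => //; apply/absE.
    exact: collinear_real.
  move=> [z [zcc zcol] <-].
  have [y [u [u1 zE]]] := collinear_line n1 hm (zcc.1.1) zcol.
  have ycc : real_cc alpha ac m y.
    by apply/absE; apply: (CC1_real_cc c_sym u1); rewrite -zE.
  have -> : O2_orbit z = O2_orbit (fun i => (y i)%:C%C).
    rewrite -(O2_orbit_act (fun i => (y i)%:C%C) (rotation_O2 u1)) zE.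
    by congr O2_orbit; apply/funext => i; rewrite rotationE.
  (* Of y and -y, exactly one has its coordinates 0 and 1 in increasing
     order. *)
  suff [s sP <-] : exists2 s, s \in P & f s = O2_orbit (fun i => (y i)%:C%C).
    by exists (enum_rank_in sP s) => //; rewrite enum_rankK_in.
  have [yi _ _] := ycc.
  have [lt|lt|/yi/eqP] := ltgtP (y i0) (y i1); last by rewrite (negbTE i01).
    exact: surj.
  by rewrite -orbN; apply: surj; [exact: real_ccN | rewrite ltrN2].
rewrite -(card_perm_lt i01) -/P.
apply: card_eq_trans (inj_card_eq _) _; last by rewrite card_eq_sym card_II.
move=> k l _ _ kl; apply: enum_val_inj.
have := enum_valP k; have := enum_valP l; rewrite !inE -!xs => l01 k01.
have E : x (enum_val k) = x (enum_val l).
  have [//|E] := real_orbit_inj kl.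
  by move: k01; rewrite E ltrN2 ltNge ltW.
by apply: perm_order_inj => i j; rewrite -!xs E.
Qed.
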